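(* Consider a GAN game with objective $V$ and a configuration $(\theta_d,\theta_g)\in\Theta_D\times\Theta_G$. Then for all $\lambda'\ge\lambda_0\ge 0$, $$DG^{\lambda=\lambda'}(\theta_d,\theta_g)=0\ \Longrightarrow\ DG^{\lambda=\lambda_0}(\theta_d,\theta_g)=0 .$$
   Context: A GAN game is $\min_{\theta_g\in\Theta_G}\max_{\theta_d\in\Theta_D}V(D_{\theta_d},G_{\theta_g})$, where $V$ is a real-valued objective function, $\theta_d$ parametrizes a discriminator $D_{\theta_d}$ (a function on the data space) and $\theta_g$ parametrizes a generator $G_{\theta_g}$. Let $\|\cdot\|$ be a fixed norm (or seminorm) on discriminators. For $\lambda\ge 0$ the proximal objective is $$V^{\lambda}(D_{\theta_d},G_{\theta_g})=\max_{\tilde\theta_d\in\Theta_D}\{V(D_{\tilde\theta_d},G_{\theta_g})-\lambda\|D_{\tilde\theta_d}-D_{\theta_d}\|^2\}.$$ The proximal duality gap is $DG^{\lambda}(\theta_d,\theta_g)=V_{D_w}(\theta_g)-V^{\lambda}_{G_w}(\theta_d)$, where $V_{D_w}(\theta_g)=\max_{\theta_d'\in\Theta_D}V(D_{\theta_d'},G_{\theta_g})$ and $V^{\lambda}_{G_w}(\theta_d)=\min_{\theta_g'\in\Theta_G}V^{\lambda}(D_{\theta_d},G_{\theta_g'})$. All displayed maxima and minima are assumed to exist. *)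

(* Defs.v *)
From HB Require Import structures.
From mathcomp Require Import all_boot all_order all_algebra.
From mathcomp Require Import boolp classical_sets functions reals.

Set Implicit Arguments.
Unset Strict Implicit.
Unset Printing Implicit Defensive.

Import Order.TTheory GRing.Theory Num.Theory.
Local Open Scope classical_set_scope.
Local Open Scope ring_scope.

Section Extrema.
Context {R : realType} {T : Type}.
Implicit Types (S : set T) (f : T -> R).

Definition attains_max S f := exists2 t, S t & forall s, S s -> f s <= f t.
Definition attains_min S f := exists2 t, S t & forall s, S s -> f t <= f s.

(* These are the maximum and the minimum only when they are attained; see
   [max_overE] and [min_overE]. *)
Definition max_over S f : R := sup (f @` S).
Definition min_over S f : R := inf (f @` S).

Lemma max_overE S f t :
  S t -> (forall s, S s -> f s <= f t) -> max_over S f = f t.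
Proof.
move=> St ft; have ub : ubound (f @` S) (f t) by move=> _ [s Ss <-]; exact: ft.
apply/eqP; rewrite eq_le; apply/andP; split.
  by apply: ge_sup => //; exists (f t), t.
by apply: ub_le_sup; [exists (f t) | exists t].
Qed.

Lemma min_overE S f t :
  S t -> (forall s, S s -> f t <= f s) -> min_over S f = f t.
Proof.
move=> St ft; have lb : lbound (f @` S) (f t) by move=> _ [s Ss <-]; exact: ft.
apply/eqP; rewrite eq_le; apply/andP; split.
  by apply: ge_inf; [exists (f t) | exists t].
by apply: lb_le_inf => //; exists (f t), t.
Qed.

End Extrema.

(* A seminorm on the linear subspace [W] of [E]; nothing is required of [N]
   outside [W].  (For instance, an L^p seminorm is real-valued only on a
   subspace of the space of all functions.) *)
Record seminorm_on {R : realType} {E : lmodType R} (W : {pred E}) (N : E -> R)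
    : Prop := SeminormOn {
  seminorm_dom : GRing.submod_closed W ;
  seminorm_ge0 : forall x, x \in W -> 0 <= N x ;
  seminormZ : forall (a : R) x, x \in W -> N (a *: x) = `|a| * N x ;
  seminormD : forall x y, x \in W -> y \in W -> N (x + y) <= N x + N y
}.

(* [X] is the data space, [Z] the latent space, and discriminators take values
   in [Y] (real-valued discriminators are the case [Y := R^o]). *)
Record ganGame (R : realType) (X Z : Type) (Y : lmodType R) := GanGame {
  dparam : Type ;
  gparam : Type ;
  ThetaD : set dparam ;
  ThetaG : set gparam ;
  disc : dparam -> X -> Y ;
  gen : gparam -> Z -> X ;
  objective : (X -> Y) -> (Z -> X) -> R
}.

Arguments ThetaD {R X Z Y} g _ : rename.
Arguments ThetaG {R X Z Y} g _ : rename.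
Arguments objective {R X Z Y} g _ _ : rename.

Section ProximalDualityGap.
Context {R : realType} {X Z : Type} {Y : lmodType R}.
Variables (g : ganGame X Z Y) (N : (X -> Y) -> R).
Implicit Types (lambda : R) (td : dparam g) (tg : gparam g).

Definition payoff td tg : R := objective g (disc td) (gen tg).

Definition VDw tg : R := max_over (ThetaD g) (payoff ^~ tg).

(* The quantity maximized over [td'] in the proximal objective at [td], [tg]. *)
Definition prox_payoff lambda td tg td' : R :=
  payoff td' tg - lambda * N (disc td' - disc td) ^+ 2.

Definition prox_objective lambda td tg : R :=
  max_over (ThetaD g) (prox_payoff lambda td tg).

Definition prox_VGw lambda td : R :=
  min_over (ThetaG g) (prox_objective lambda td).

Definition prox_DG lambda td tg : R := VDw tg - prox_VGw lambda td.

Record extrema_exist : Prop := ExtremaExist {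
  exists_VDw : forall tg, ThetaG g tg ->
    attains_max (ThetaD g) (payoff ^~ tg) ;
  exists_minmax : attains_min (ThetaG g) VDw ;
  exists_prox_objective : forall lambda td tg,
    0 <= lambda -> ThetaD g td -> ThetaG g tg ->
    attains_max (ThetaD g) (prox_payoff lambda td tg) ;
  exists_prox_VGw : forall lambda td, 0 <= lambda -> ThetaD g td ->
    attains_min (ThetaG g) (prox_objective lambda td)
}.

End ProximalDualityGap.

(* Main.v *)
(* The proximal gap is nonnegative, since the proximal objective never exceeds
   [VDw], and it is nondecreasing in [lambda], since increasing [lambda] lowers
   the proximal objective; so a zero at [lambda'] forces a zero below it. *)

Require Import Defs.
From HB Require Import structures.
From mathcomp Require Import all_boot all_order all_algebra.
From mathcomp Require Import boolp classical_sets functions reals.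

Set Implicit Arguments.
Unset Strict Implicit.
Unset Printing Implicit Defensive.

Import Order.TTheory GRing.Theory Num.Theory.
Local Open Scope classical_set_scope.
Local Open Scope ring_scope.

(** A maximizer of [f] is a competitor in the maximum of [h]. Both maxima must be attained because
    [sup] falls back to a default value on sets without a supremum. *)
Lemma le_max_over (R : realType) (T : Type) (S : set T) (f h : T -> R) :
  attains_max S f -> attains_max S h -> (forall s, S s -> f s <= h s) ->
  max_over S f <= max_over S h.
Proof.
move=> [t St ft] [u Su hu] fh; rewrite (max_overE St ft) (max_overE Su hu).
exact: le_trans (fh t St) (hu t St).
Qed.

Lemma min_over_le (R : realType) (T : Type) (S : set T) (f : T -> R) s :
  attains_min S f -> S s -> min_over S f <= f s.
Proof. by move=> [t St ft] Ss; rewrite (min_overE St ft); exact: ft. Qed.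

Lemma le_min_over (R : realType) (T : Type) (S : set T) (f h : T -> R) :
  attains_min S f -> attains_min S h -> (forall s, S s -> f s <= h s) ->
  min_over S f <= min_over S h.
Proof.
move=> fS [u Su hu] fh; rewrite (min_overE Su hu).
exact: le_trans (min_over_le fS Su) (fh u Su).
Qed.

Section ProximalMonotonicity.
Context {R : realType} {X Z : Type} {Y : lmodType R}.
Variables (g : ganGame X Z Y) (N : (X -> Y) -> R).
Hypothesis g_extrema : extrema_exist g N.
Implicit Types (lambda : R) (td : dparam g) (tg : gparam g).

(** The penalty is a nonnegative multiple of a square, so the comparison already holds at each
    [td']. *)
Lemma prox_objective_le_VDw lambda td tg :
  0 <= lambda -> ThetaD g td -> ThetaG g tg ->
  prox_objective N lambda td tg <= VDw tg.
Proof.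
move=> lambda_ge0 td_in tg_in; apply: le_max_over => [||td' _].
- exact: (exists_prox_objective g_extrema).
- exact: (exists_VDw g_extrema).
- by rewrite lerBlDr lerDl mulr_ge0 ?sqr_ge0.
Qed.

Lemma prox_objective_antitone lambda lambda' td tg :
  0 <= lambda -> lambda <= lambda' -> ThetaD g td -> ThetaG g tg ->
  prox_objective N lambda' td tg <= prox_objective N lambda td tg.
Proof.
move=> lambda_ge0 le_lambda td_in tg_in; apply: le_max_over => [||td' _].
(* The maximum is assumed only for nonnegative weights; [lambda'] inherits its sign from
   [lambda]. *)
- apply: (exists_prox_objective g_extrema) => //; exact: le_trans le_lambda.
- exact: (exists_prox_objective g_extrema).
- by rewrite lerD2l lerN2 ler_wpM2r ?sqr_ge0.
Qed.

(** The generator [tg] itself competes in the minimum defining [prox_VGw], which bounds that minimum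
    by [VDw tg]. *)
Lemma prox_DG_ge0 lambda td tg :
  0 <= lambda -> ThetaD g td -> ThetaG g tg -> 0 <= prox_DG N lambda td tg.
Proof.
move=> lambda_ge0 td_in tg_in; rewrite subr_ge0.
apply: le_trans (prox_objective_le_VDw lambda_ge0 td_in tg_in).
by apply: min_over_le => //; exact: (exists_prox_VGw g_extrema).
Qed.

(** The term [VDw tg] is independent of the weight, so only the subtracted minimum over generators
    has to be compared. *)
Lemma prox_DG_monotone lambda lambda' td tg :
  0 <= lambda -> lambda <= lambda' -> ThetaD g td ->
  prox_DG N lambda td tg <= prox_DG N lambda' td tg.
Proof.
move=> lambda_ge0 le_lambda td_in; rewrite lerD2l lerN2.
apply: le_min_over => [||tg' tg'_in].
- apply: (exists_prox_VGw g_extrema) => //; exact: le_trans le_lambda.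
- exact: (exists_prox_VGw g_extrema).
- exact: prox_objective_antitone.
Qed.

End ProximalMonotonicity.

Theorem theorem3 (R : realType) (X Z : Type) (Y : lmodType R)
  (g : ganGame X Z Y)
  (W : {pred X -> Y}) (N : (X -> Y) -> R)
  (N_seminorm : seminorm_on W N)
  (disc_in_W : forall td : dparam g, ThetaD g td -> disc td \in W)
  (g_extrema : extrema_exist g N)
  (theta_d : dparam g) (theta_g : gparam g)
  (theta_d_in : ThetaD g theta_d) (theta_g_in : ThetaG g theta_g) :
  forall lambda' lambda0 : R, 0 <= lambda0 -> lambda0 <= lambda' ->
    prox_DG N lambda' theta_d theta_g = 0 ->
    prox_DG N lambda0 theta_d theta_g = 0.
Proof.
move=> lambda' lambda0 lambda0_ge0 le_lambda DG0.
(* Only the upper bound remains; its right-hand side 0 is rewritten as the gap at [lambda']. *)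
apply/eqP; rewrite eq_le (prox_DG_ge0 g_extrema) // andbT -DG0.
exact: (prox_DG_monotone g_extrema).
Qed.
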